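(* Let $\epsilon>0$. Let $f:\mathbb{F}_2^n\to\{0,1\}$ have expectation $a=\mathbb{E}f$ and let $k=\dim(\mathrm{Span}(\mathrm{Spec}_\epsilon(f)))$, with $k\ge1$. Let $h:\{\pm1\}^n\to[0,1]$ be $$h(\mathbf x)=\mathbf 1\left\{\sum_{i=1}^kx_i>b\right\}+\lambda\cdot\mathbf 1\left\{\sum_{i=1}^kx_i=b\right\}$$ for some $b\in\mathbb{N}=\{0,1,2,\dots\}$ and $\lambda\in(0,1]$ such that $\mathbb{E}h=a$. Then $\hat h_i$, $i\in\{1,\dots,k\}$, are all equal, and $$\epsilon\le a^{-1}\hat h_1 .$$
   Context: Expectations are with respect to the uniform measure on $\mathbb{F}_2^n$ or on $\{\pm1\}^n$. For $f:\mathbb{F}_2^n\to\{0,1\}$ and $\mathbf y\in\mathbb{F}_2^n$, $\hat f(\mathbf y)=2^{-n}\sum_{\mathbf x\in\mathbb{F}_2^n}f(\mathbf x)(-1)^{\langle\mathbf x,\mathbf y\rangle}$, and $\|f\|_1=\mathbb{E}|f|=\mathbb{E}f$. The $\epsilon$-spectrum of $f$ is $$\mathrm{Spec}_\epsilon(f)=\{\mathbf y\in\mathbb{F}_2^n:|\hat f(\mathbf y)|>\epsilon\|f\|_1\},$$ and $\mathrm{Span}$, $\dim$ are taken over $\mathbb{F}_2$. For $h:\{\pm1\}^n\to\mathbb{R}$, $\hat h_i=\mathbb{E}[h(\mathbf X)X_i]$ with $\mathbf X$ uniform on $\{\pm1\}^n$. *)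

(* Defs.v *)
From HB Require Import structures.
From mathcomp Require Import all_boot all_order all_algebra.
Set Implicit Arguments.
Unset Strict Implicit.
Unset Printing Implicit Defensive.
Import Order.TTheory GRing.Theory Num.Theory.
Local Open Scope ring_scope.

Definition mean (R : realFieldType) (T : finType) (F : T -> R) : R :=
  #|T|%:R^-1 * \sum_x F x.

Definition norm1 (R : realFieldType) (T : finType) (F : T -> R) : R :=
  mean (fun x => `|F x|).

Definition dotF2 (n : nat) (x y : 'rV['F_2]_n) : 'F_2 :=
  \sum_(i < n) x 0 i * y 0 i.

(* The exponent is the representative in {0, 1} of the inner product. *)
Definition fourier (R : realFieldType) (n : nat) (f : 'rV['F_2]_n -> R)
    (y : 'rV['F_2]_n) : R :=
  2%:R ^- n * \sum_x f x * (-1) ^+ nat_of_ord (dotF2 x y).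

Definition Spec (R : realFieldType) (n : nat) (eps : R)
    (f : 'rV['F_2]_n -> R) : {set 'rV['F_2]_n} :=
  [set y | eps * norm1 f < `|fourier f y|].

(* {-1, 1}^n is encoded as {ffun 'I_n -> bool}: false stands for the
   coordinate 1 and true for the coordinate -1. *)
Definition cube (n : nat) := {ffun 'I_n -> bool}.

Definition cube_coord (R : realFieldType) (n : nat) (x : cube n) (i : 'I_n) : R :=
  (-1) ^+ nat_of_bool (x i).

Definition degree1_coef (R : realFieldType) (n : nat) (h : cube n -> R)
    (i : 'I_n) : R :=
  mean (fun x : cube n => h x * cube_coord R x i).

(* Coordinates are numbered from 0, so the first k of them are those with
   index i < k. *)
Definition threshold (R : realFieldType) (n k b : nat) (lam : R)
    (x : cube n) : R :=
  let s := \sum_(i < n | (i < k)%N) cube_coord R x i in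
  (b%:R < s)%R%:R + lam * (s == b%:R)%R%:R.

(* Main.v *)
(* Choose linearly independent [y_0, ..., y_(k-1)] in the spectrum, extend them
   to a basis of F_2^n, and let [phi x] list the characters [(-1)^<x, y_i>],
   the i-th one multiplied by the sign of [fourier f y_i]; [phi] is a bijection
   from F_2^n to the cube. With [s] the sum of the first [k] coordinates of
   [phi x], the function [(h (phi x) - f x) * (s - b)] is nonnegative pointwise
   (Neyman-Pearson), and [f] and [h] have the same mean, so that
     sum_(i < k) |fourier f y_i| = E[f s] <= E[(h o phi) s] = k * hhat_1,
   while each of the k terms on the left exceeds eps * a. *)
Require Import Defs.
From mathcomp Require Import all_boot all_order all_algebra.
From mathcomp Require Import perm.
Set Implicit Arguments.
Unset Strict Implicit.
Unset Printing Implicit Defensive.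
Import Order.TTheory GRing.Theory Num.Theory.
Local Open Scope ring_scope.

(** Induction on [X]: a vector is kept exactly when it lies outside the span of those after it. *)
Lemma subset_basis (K : fieldType) (vT : vectType K) (X : seq vT) :
  exists2 Y, basis_of <<X>>%VS Y & {subset Y <= X}.
Proof.
elim: X => [|v X [Y /andP[/eqP spanY freeY] subYX]].
  by exists [::]; rewrite // span_nil nil_basis.
have [vX | vNX] := boolP (v \in <<X>>%VS).
  exists Y; last by move=> y /subYX yX; rewrite inE yX orbT.
  rewrite /basis_of freeY andbT spanY span_cons eq_sym.
  by apply/eqP/addv_idPr; rewrite -memvE.
exists (v :: Y).
  by rewrite /basis_of free_cons freeY !span_cons spanY vNX eqxx.
by move=> y; rewrite !inE => /predU1P[->|/subYX ->]; rewrite ?eqxx ?orbT.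
Qed.

(** A basis drawn from [X] is followed by a basis of a complement. The vectors of [X] come first so
    that they match the first coordinates of the cube. *)
Lemma extend_subset_basis (K : fieldType) (vT : vectType K) (X : seq vT) :
  exists2 Y, basis_of fullv Y & {subset take (\dim <<X>>) Y <= X}.
Proof.
have [Y basisY subYX] := subset_basis X.
exists (Y ++ vbasis (<<X>>^C)%VS).
  rewrite -(addv_complf <<X>>); apply: cat_basis => //; last exact: vbasisP.
  by apply/directv_addP; exact: capv_compl.
have -> : \dim <<X>> = size Y.
  by rewrite (@size_basis _ _ _ _ (in_tuple Y)).
by rewrite take_size_cat.
Qed.

Section Dot.
Variable n : nat.
Implicit Types x y u : 'rV['F_2]_n.

Lemma dotF2Bl x u y : dotF2 (x - u) y = dotF2 x y - dotF2 u y.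
Proof. by rewrite /dotF2 -sumrB; apply: eq_bigr => i _; rewrite !mxE mulrBl. Qed.

Lemma dotF2_sumr x m (c : 'I_m -> 'F_2) (Y : 'I_m -> 'rV['F_2]_n) :
  dotF2 x (\sum_j c j *: Y j) = \sum_j c j * dotF2 x (Y j).
Proof.
rewrite /dotF2; under eq_bigr do rewrite summxE mulr_sumr.
rewrite exchange_big; apply: eq_bigr => j _; rewrite mulr_sumr.
by apply: eq_bigr => i _; rewrite mxE mulrCA.
Qed.

Lemma dotF2_delta x i : dotF2 x (delta_mx 0 i) = x 0 i.
Proof.
rewrite /dotF2 (bigD1 i) //= mxE !eqxx mulr1 big1 ?addr0 // => j ne_ji.
by rewrite mxE (negPf ne_ji) andbF mulr0.
Qed.

(** Nondegeneracy of the pairing: [x - u] is orthogonal to a basis, hence to every vector, and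
    pairing with [delta_mx 0 i] reads off its coordinates. *)
Lemma dotF2_basis_inj (Y : n.-tuple 'rV['F_2]_n) x u :
  basis_of fullv Y -> (forall i : 'I_n, dotF2 x Y`_i = dotF2 u Y`_i) -> x = u.
Proof.
move=> /andP[/eqP spanY _] eq_xu.
suff dot0 y : dotF2 (x - u) y = 0.
  apply/rowP => i; apply/eqP; rewrite -subr_eq0.
  by have := dot0 (delta_mx 0 i); rewrite dotF2_delta !mxE => ->.
have /coord_span -> : y \in <<Y>>%VS by rewrite spanY memvf.
rewrite dotF2_sumr big1 // => i _.
by rewrite dotF2Bl eq_xu subrr mulr0.
Qed.

Lemma nat_of_F2_eq (c d : 'F_2) :
  (nat_of_ord c == 1)%N = (nat_of_ord d == 1)%N -> c = d.
Proof.
by case: c d => [[|[|c]] ltc] [[|[|d]] ltd] //= _; apply: val_inj.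
Qed.

Lemma signr_F2 (R : pzRingType) (c : 'F_2) :
  (-1) ^+ nat_of_ord c = (-1) ^+ (nat_of_ord c == 1)%N :> R.
Proof. by case: c => [[|[|c]]]. Qed.

(** The map [phi] of the overview. Since [true] encodes -1, multiplying the character by the sign
    [s i] becomes an exclusive or. *)
Definition dot_cube (Y : seq 'rV['F_2]_n) (s : 'I_n -> bool) x : cube n :=
  [ffun i : 'I_n => s i (+) (nat_of_ord (dotF2 x Y`_i) == 1)%N].

Lemma card_cube : #|cube n| = (2 ^ n)%N.
Proof. by rewrite card_ffun card_bool card_ord. Qed.

Lemma card_rVF2 : #|'rV['F_2]_n| = (2 ^ n)%N.
Proof. by rewrite card_mx card_Fp // mul1n. Qed.

Lemma dot_cube_bij (Y : n.-tuple 'rV['F_2]_n) (s : 'I_n -> bool) :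
  basis_of fullv Y -> bijective (dot_cube Y s).
Proof.
move=> basisY; apply: inj_card_bij; last by rewrite card_cube card_rVF2.
move=> x u /ffunP eq_xu; apply: (dotF2_basis_inj basisY) => i.
by apply: nat_of_F2_eq; have := eq_xu i; rewrite !ffunE => /addbI.
Qed.

End Dot.

Lemma cube_coord_dot_cube (R : realFieldType) n (Y : seq 'rV['F_2]_n) s x i :
  cube_coord R (dot_cube Y s x) i
    = (-1) ^+ s i * (-1) ^+ nat_of_ord (dotF2 x Y`_i).
Proof. by rewrite /cube_coord ffunE signr_addb signr_F2. Qed.

Lemma mean_bij (R : realFieldType) (T U : finType) (phi : T -> U) (F : U -> R) :
  bijective phi -> mean F = mean (F \o phi).
Proof.
move=> bij_phi; rewrite /mean (bij_eq_card bij_phi); congr (_ * _).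
by rewrite (reindex phi) //; exact: onW_bij.
Qed.

Lemma fourier_mean (R : realFieldType) n (f : 'rV['F_2]_n -> R) y :
  fourier f y = mean (fun x => f x * (-1) ^+ nat_of_ord (dotF2 x y)).
Proof. by rewrite /fourier /mean card_rVF2 natrX. Qed.

Section Mean.
Variables (R : realFieldType) (T : finType).
Implicit Types F G : T -> R.

Lemma meanB F G : mean (fun x => F x - G x) = mean F - mean G.
Proof. by rewrite /mean -mulrBr sumrB. Qed.

Lemma meanZ c F : mean (fun x => c * F x) = c * mean F.
Proof. by rewrite /mean -mulr_sumr mulrCA. Qed.

Lemma mean_sum (I : Type) (r : seq I) (P : pred I) (F : I -> T -> R) :
  mean (fun x => \sum_(i <- r | P i) F i x) = \sum_(i <- r | P i) mean (F i).
Proof. by rewrite /mean exchange_big mulr_sumr. Qed.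

Lemma eq_mean F G : F =1 G -> mean F = mean G.
Proof. by move=> eqFG; congr (_ * _); apply: eq_bigr => x _. Qed.

Lemma mean_ge0 F : (forall x, 0 <= F x) -> 0 <= mean F.
Proof. by move=> F0; rewrite mulr_ge0 ?invr_ge0 ?ler0n // sumr_ge0. Qed.

(* As [f] and [h] have the same mean, [S] may be replaced by [S - b] in the
   difference of the two sides. *)
Lemma neyman_pearson (f h S : T -> R) (b : R) :
    mean f = mean h -> (forall x, 0 <= (h x - f x) * (S x - b)) ->
  mean (fun x => f x * S x) <= mean (fun x => h x * S x).
Proof.
move=> eq_fh hf; rewrite -subr_ge0 -meanB.
rewrite (_ : mean _ = mean (fun x => (h x - f x) * (S x - b))) ?mean_ge0 //.
apply/eqP; rewrite -subr_eq0 -meanB.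
rewrite (@eq_mean _ (fun x => b * (h x - f x))).
  by rewrite meanZ meanB eq_fh subrr mulr0.
by move=> x; rewrite mulrBr !mulrBl opprB addrC subrK mulrBr !(mulrC b).
Qed.

End Mean.

Lemma ler_norm_fourier (R : realFieldType) n (f : 'rV['F_2]_n -> R) y :
  `|fourier f y| <= norm1 f.
Proof.
rewrite fourier_mean /norm1 /mean normrM ger0_norm ?invr_ge0 ?ler0n //.
rewrite ler_wpM2l ?invr_ge0 ?ler0n //; apply: le_trans (ler_norm_sum _ _ _) _.
by apply: ler_sum => x _; rewrite normrM normr_sign mulr1.
Qed.

(** When the sum exceeds [b] the threshold is 1, at least [c]; when it is below [b] the threshold is
    0, at most [c]; at equality the second factor vanishes. *)
Lemma threshold_gap (R : realFieldType) n k b (lam : R) (x : cube n) (c : R) :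
    0 <= c <= 1 ->
  0 <= (threshold k b lam x - c)
       * (\sum_(i < n | (i < k)%N) cube_coord R x i - b%:R).
Proof.
case/andP=> c0 c1; rewrite /threshold; set S := \sum_(i < n | _) _.
have [ltbS | ltSb | ->] := ltgtP b%:R S; last by rewrite subrr mulr0.
  by rewrite mulr0 addr0 mulr_ge0 ?subr_ge0 // ltW.
by rewrite mulr0 addr0 mulr_le0 ?subr_le0 // ltW.
Qed.

Lemma threshold_tperm (R : realFieldType) n k b (lam : R) (i j : 'I_n)
    (x : cube n) : (i < k)%N -> (j < k)%N ->
  threshold k b lam [ffun l => x (tperm i j l)] = threshold k b lam x.
Proof.
move=> ltik ltjk; rewrite /threshold.
suff -> : \sum_(l < n | (l < k)%N) cube_coord R [ffun l => x (tperm i j l)] l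
          = \sum_(l < n | (l < k)%N) cube_coord R x l by [].
rewrite [RHS](reindex_inj (@perm_inj _ (tperm i j))).
apply: eq_big => l; last by rewrite /cube_coord ffunE.
by case: tpermP => [->|->|//]; rewrite ltik ltjk.
Qed.

(** Swapping coordinates [i] and [j] is an involution of the cube that fixes the threshold function
    and exchanges the two coefficients. *)
Lemma degree1_coef_threshold (R : realFieldType) n k b (lam : R) (i j : 'I_n) :
    (i < k)%N -> (j < k)%N ->
  degree1_coef (threshold k b lam) i = degree1_coef (threshold k b lam) j.
Proof.
move=> ltik ltjk; rewrite /degree1_coef.
pose phi (x : cube n) : cube n := [ffun l => x (tperm i j l)].
have phiK : involutive phi by move=> x; apply/ffunP => l; rewrite !ffunE tpermK.
rewrite (mean_bij _ (inv_bij phiK)); apply: eq_mean => x /=.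
by rewrite threshold_tperm // /cube_coord ffunE tpermL.
Qed.

(** The chosen sign is that of the Fourier coefficient, so their product is the absolute value. *)
Lemma mean_dot_cube (R : realFieldType) n (f : 'rV['F_2]_n -> R)
    (Y : seq 'rV['F_2]_n) (i : 'I_n) :
  mean (fun x => f x * cube_coord R
                   (dot_cube Y (fun l : 'I_n => fourier f Y`_l < 0) x) i)
    = `|fourier f Y`_i|.
Proof.
rewrite normrEsign [X in _ = _ * X]fourier_mean -meanZ.
by apply: eq_mean => x; rewrite cube_coord_dot_cube mulrCA.
Qed.

Lemma sum_fourier_le (R : realFieldType) n (f : 'rV['F_2]_n -> R)
    (Y : n.-tuple 'rV['F_2]_n) k b (lam : R) :
    (forall x, 0 <= f x <= 1) -> basis_of fullv Y ->
    mean (threshold k b lam : cube n -> R) = mean f ->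
  \sum_(i < n | (i < k)%N) `|fourier f Y`_i|
    <= \sum_(i < n | (i < k)%N) degree1_coef (threshold k b lam) i.
Proof.
move=> f01 basisY mean_h; pose s (l : 'I_n) := fourier f Y`_l < 0.
have bij_phi := dot_cube_bij s basisY.
pose S (x : cube n) := \sum_(i < n | (i < k)%N) cube_coord R x i.
have -> : \sum_(i < n | (i < k)%N) `|fourier f Y`_i|
          = mean (fun x => f x * S (dot_cube Y s x)).
  under eq_bigr do rewrite -mean_dot_cube.
  by rewrite -mean_sum; apply: eq_mean => x; rewrite mulr_sumr.
(* The bijection [dot_cube Y s] carries one uniform measure to the other, so means over the cube can
   be taken over the vector space. *)
have -> : \sum_(i < n | (i < k)%N) degree1_coef (threshold k b lam) i
          = mean (fun x => threshold k b lam (dot_cube Y s x)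
                           * S (dot_cube Y s x)).
  rewrite /degree1_coef -mean_sum (mean_bij _ bij_phi).
  by apply: eq_mean => x; rewrite /= mulr_sumr.
apply: (@neyman_pearson _ _ _ _ _ b%:R).
  by rewrite -mean_h (mean_bij _ bij_phi).
by move=> x; exact: threshold_gap.
Qed.

Theorem theorem9 (R : realFieldType) (n : nat) (eps : R) (eps_gt0 : 0 < eps)
    (f : 'rV['F_2]_n -> R) (f01 : forall x, f x = 0 \/ f x = 1)
    (a : R) (aE : a = mean f)
    (k : nat) (kE : k = \dim <<enum (Spec eps f)>>%VS) (k_ge1 : (1 <= k)%N)
    (b : nat) (lam : R) (lam_gt0 : 0 < lam) (lam_le1 : lam <= 1)
    (h : cube n -> R) (hE : forall x, h x = threshold k b lam x)
    (mean_h : mean h = a) :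
  (forall i j : 'I_n, (i < k)%N -> (j < k)%N ->
     degree1_coef h i = degree1_coef h j) /\
  (exists2 i1 : 'I_n, nat_of_ord i1 = 0%N & eps <= a^-1 * degree1_coef h i1).
Proof.
have coefE i : degree1_coef h i = degree1_coef (threshold k b lam) i.
  by apply: eq_mean => x; rewrite hE.
split=> [i j ltik ltjk|].
  by rewrite !coefE (degree1_coef_threshold _ _ ltik ltjk).
have dim_n : \dim {: 'rV['F_2]_n} = n by rewrite dimvf /dim /= mul1n.
have le_kn : (k <= n)%N by rewrite kE -[leqRHS]dim_n dimvS ?subvf.
have lt0n : (0 < n)%N by exact: leq_trans le_kn.
exists (Ordinal lt0n) => //.
have [Y0 basisY0 specY0] := extend_subset_basis (enum (Spec eps f)).
have sizeY0 : size Y0 == n.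
  by rewrite -(size_basis (X := in_tuple Y0) basisY0) dim_n.
pose Y := Tuple sizeY0.
have f_ge0 x : 0 <= f x <= 1 by case: (f01 x) => ->; rewrite ?lexx ?ler01.
have norm1f : norm1 f = a.
  by rewrite aE; apply: eq_mean => x; rewrite ger0_norm //; case/andP: (f_ge0 x).
(* As [k] is the dimension of the span, the first [k] basis vectors belong to the spectrum. *)
have specY (i : 'I_n) : (i < k)%N -> eps * a < `|fourier f Y`_i|.
  move=> ltik; have : Y`_i \in Spec eps f.
    rewrite -mem_enum; apply: specY0; rewrite -kE -(nth_take _ ltik).
    by rewrite mem_nth // size_takel // (eqP sizeY0).
  by rewrite inE norm1f.
(* If [a] were 0, the coefficient at the first basis vector would be both positive and at most
   [norm1 f = 0]. *)
have a_gt0 : 0 < a.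
  have a_ge0 : 0 <= a by rewrite aE mean_ge0 // => x; case/andP: (f_ge0 x).
  rewrite lt_neqAle a_ge0 andbT; apply/eqP => a0.
  have := lt_le_trans (specY (Ordinal lt0n) k_ge1) (ler_norm_fourier f _).
  by rewrite norm1f -a0 mulr0 ltxx.
rewrite mulrC ler_pdivlMr //.
have k_gt0 : 0 < k%:R :> R by rewrite ltr0n.
have sum_const c : \sum_(i < n | (i < k)%N) c = k%:R * c :> R.
  by rewrite (big_ord_narrow le_kn) sumr_const card_ord mulr_natl.
(* Multiplying by [k] turns both sides into constant sums over the first [k] indices: the left is
   compared termwise with the Fourier coefficients, the right is the sum of the equal degree-1
   coefficients. *)
rewrite -(ler_pM2l k_gt0) -!sum_const.
apply: le_trans (_ : \sum_(i < n | (i < k)%N) `|fourier f Y`_i| <= _).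
  by apply: ler_sum => i /specY/ltW.
have mean_thr : mean (threshold k b lam : cube n -> R) = mean f.
  by rewrite -aE -mean_h; apply: eq_mean => x; rewrite hE.
apply: le_trans (sum_fourier_le (Y := Y) f_ge0 basisY0 mean_thr) _.
apply: ler_sum => i ltik; rewrite !coefE.
by rewrite (degree1_coef_threshold (j := Ordinal lt0n) _ _ ltik).
Qed.
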